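(* Let $R$ be a ring, $G$ a finite group acting on $R$, and $H$ a subgroup of $G$. If the skew group ring $RG$ is a semisimple Artinian ring, then so is $RH$. Moreover, if $RG$ is a separable extension over $RH$, then $RG$ is a semisimple Artinian ring if and only if $RH$ is a semisimple Artinian ring.
   Context: Rings are associative with identity. $G$ acts on $R$ by ring automorphisms: $r\mapsto g(r)$ is a ring automorphism for each $g\in G$, $(g_1g_2)(r)=g_1(g_2(r))$ and $1(r)=r$. The skew group ring $RG$ is the free left $R$-module with basis $G$ and multiplication $(ag)(bh)=a\,g(b)\,gh$ for $a,b\in R$, $g,h\in G$. For a subgroup $H\le G$ (with the restricted action), $RH$ is a subring of $RG$. A ring $A$ is a separable extension over a subring $S$ if the multiplication map $A\otimes_S A\to A$, $a\otimes b\mapsto ab$, splits as a map of $A$-$A$-bimodules; i.e. there is $\sum_i a_i\otimes b_i\in A\otimes_S A$ with $\sum_i a_i\otimes b_i a=\sum_i a a_i\otimes b_i$ for all $a\in A$ and $\sum_i a_ib_i=1$. *)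

(* Defs.v *)
From HB Require Import structures.
From mathcomp Require Import all_boot all_order all_algebra all_fingroup.
From mathcomp Require Import boolp classical_sets.
From mathcomp Require Import freeg.

Set Implicit Arguments.
Unset Strict Implicit.
Unset Printing Implicit Defensive.
Import GRing.Theory.
Local Open Scope classical_set_scope.
Local Open Scope ring_scope.

(* Bijectivity of each [act g] is a consequence: its inverse is [act g^-1]. *)
Record ring_action (gT : finGroupType) (R : pzRingType) := RingAction {
  act :> gT -> {rmorphism R -> R};
  act1 : forall r, act 1%g r = r;
  actM : forall g h r, act (g * h)%g r = act g (act h r)
}.

Section Restriction.
Variables (gT : finGroupType) (R : pzRingType) (a : ring_action gT R).
Variable H : {group gT}.

Definition restr_act : ring_action (subg_of H) R :=
  @RingAction (subg_of H) R (fun h => a (sgval h))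
    (act1 a) (fun g h => actM a (sgval g) (sgval h)).

End Restriction.

(* An element x stands for the formal sum \sum_g (x g) g. *)
Definition skew_group_ring (gT : finGroupType) (R : pzRingType)
  (a : ring_action gT R) : Type := {ffun gT -> R}.

Section SkewGroupRing.
Variables (gT : finGroupType) (R : pzRingType) (a : ring_action gT R).
Local Notation RG := (skew_group_ring a).

HB.instance Definition _ := GRing.Zmodule.on RG.

Definition skew_single (r : R) (g : gT) : RG :=
  [ffun k => if k == g then r else 0].

Definition skew_one : RG := skew_single 1 1%g.

(* The coefficient of k in (\sum_g (x g) g) (\sum_h (y h) h), where only
   h = g^-1 k contributes; see [skew_singleM] for the rule on monomials. *)
Definition skew_mul (x y : RG) : RG :=
  [ffun k => \sum_g x g * a g (y (g^-1 * k)%g)].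

Fact skew_mulA : associative skew_mul.
Proof.
move=> x y z; apply/ffunP => k; rewrite !ffunE.
under eq_bigr => g _ do rewrite ffunE raddf_sum mulr_sumr.
under [RHS]eq_bigr => g _ do rewrite ffunE mulr_suml.
rewrite [RHS]exchange_big /=; apply: eq_bigr => g _.
rewrite (reindex_inj (mulgI g^-1%g)) /=; apply: eq_bigr => h _.
by rewrite rmorphM -actM mulrA mulKVg invMg invgK mulgA mulgK.
Qed.

Fact skew_mul1r : left_id skew_one skew_mul.
Proof.
move=> x; apply/ffunP => k; rewrite ffunE (bigD1 1%g) //= big1 => [|g g1].
  by rewrite ffunE eqxx act1 mul1r invg1 mul1g addr0.
by rewrite ffunE (negPf g1) mul0r.
Qed.

Fact skew_mulr1 : right_id skew_one skew_mul.
Proof.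
move=> x; apply/ffunP => k; rewrite ffunE (bigD1 k) //= big1 => [|g gk].
  by rewrite ffunE mulVg eqxx rmorph1 mulr1 addr0.
by rewrite ffunE -eq_mulVg1 (negPf gk) rmorph0 mulr0.
Qed.

Fact skew_mulDl : left_distributive skew_mul +%R.
Proof.
move=> x y z; apply/ffunP => k; rewrite !ffunE -big_split /=.
by apply: eq_bigr => g _; rewrite ffunE mulrDl.
Qed.

Fact skew_mulDr : right_distributive skew_mul +%R.
Proof.
move=> x y z; apply/ffunP => k; rewrite !ffunE -big_split /=.
by apply: eq_bigr => g _; rewrite ffunE rmorphD mulrDr.
Qed.

HB.instance Definition _ := GRing.Zmodule_isPzRing.Build RG
  skew_mulA skew_mul1r skew_mulr1 skew_mulDl skew_mulDr.

Lemma skew_singleM (r s : R) (g h : gT) :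
  skew_single r g * skew_single s h = skew_single (r * a g s) (g * h)%g.
Proof.
apply/ffunP => k; rewrite !ffunE (bigD1 g) //= big1 => [|l lg].
  rewrite !ffunE eqxx addr0 -(inj_eq (mulgI g)) mulKVg.
  by case: ifP => //; rewrite rmorph0 mulr0.
by rewrite ffunE (negPf lg) mul0r.
Qed.

End SkewGroupRing.

Section Inclusion.
Variables (gT : finGroupType) (R : pzRingType) (a : ring_action gT R).
Variable H : {group gT}.
Local Notation RG := (skew_group_ring a).
Local Notation RH := (skew_group_ring (restr_act a H)).

(* [insub g] is [Some h] with [sgval h = g] if g lies in H, else [None]. *)
Definition skew_incl (x : RH) : RG :=
  [ffun g => if insub g is Some h then x h else 0].

Lemma skew_inclE (x : RH) (h : subg_of H) : skew_incl x (sgval h) = x h.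
Proof. by rewrite ffunE valK. Qed.

Lemma skew_incl_out (x : RH) (g : gT) : g \notin H -> skew_incl x g = 0.
Proof. by move=> gH; rewrite ffunE insubN. Qed.

Lemma skew_incl_inj : injective skew_incl.
Proof. by move=> x y xy; apply/ffunP => h; rewrite -!skew_inclE xy. Qed.

Fact skew_incl_zmod_morphism : zmod_morphism skew_incl.
Proof.
move=> x y; apply/ffunP => g; rewrite !ffunE.
by case: insubP => [h _ _|_]; rewrite ?subr0 // !ffunE.
Qed.

Fact skew_incl_monoid_morphism : monoid_morphism skew_incl.
Proof.
split=> [|x y]; apply/ffunP => g.
  rewrite !ffunE; case: insubP => [h _ <-|gH]; first by rewrite ffunE.
  by case: eqP gH => // ->; rewrite group1.
have -> : (skew_incl x * skew_incl y) g =
    \sum_(h : subg_of H) x h * a (sgval h) (skew_incl y ((sgval h)^-1 * g)%g).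
  rewrite ffunE (bigID (mem H)) /= [X in _ + X]big1 ?addr0 => [|k kH]; last first.
    by rewrite skew_incl_out ?mul0r.
  rewrite (reindex_onto (@sgval gT H) (subg H)) /= => [|k kH]; last exact: subgK.
  apply: eq_big => [h|h _]; first by rewrite subgP sgvalK eqxx.
  by rewrite skew_inclE.
have [gH|gH] := boolP (g \in H).
  rewrite -(subgK g gH) -[val _]/(sgval _) skew_inclE ffunE; apply: eq_bigr => h _.
  by rewrite -[((sgval h)^-1 * _)%g]/(sgval (h^-1 * subg H g)%g) skew_inclE.
rewrite skew_incl_out // big1 // => h _; rewrite skew_incl_out ?rmorph0 ?mulr0 //.
by rewrite groupMl // groupV subgP.
Qed.

HB.instance Definition _ :=
  GRing.isZmodMorphism.Build RH RG skew_incl skew_incl_zmod_morphism.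
HB.instance Definition _ :=
  GRing.isMonoidMorphism.Build RH RG skew_incl skew_incl_monoid_morphism.

End Inclusion.

(* Semisimple Artinian is taken in the classical sense: left Artinian with zero
   Jacobson radical.  The zero ring qualifies. *)
Section SemisimpleArtinian.
Variable A : pzRingType.

Definition left_ideal (I : set A) :=
  I 0 /\ forall c x y, I x -> I y -> I (c * x + y).

Definition maximal_left_ideal (M : set A) :=
  [/\ left_ideal M, ~ M 1 &
      forall I, left_ideal I -> ~ I 1 -> M `<=` I -> I = M].

Definition jacobson_radical : set A :=
  [set x | forall M, maximal_left_ideal M -> M x].

Definition left_artinian := forall I : nat -> set A,
  (forall n, left_ideal (I n)) -> (forall n, I n.+1 `<=` I n) ->
  exists N, forall n, (N <= n)%N -> I n = I N.

Definition semisimple_artinian :=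
  left_artinian /\ jacobson_radical = [set 0].

End SemisimpleArtinian.

(* The abelian group A (x)_S A, where S is a ring acting on A by multiplication
   through f (the inclusion, when S is a subring): the free abelian group on
   A * A modulo the subgroup generated by the usual relators. *)
Section Tensor.
Variables (S A : pzRingType) (f : {rmorphism S -> A}).
Local Notation free := {freeg (A * A)%type}.
Local Notation gen x y := (<< (x, y) >> : free).

Inductive tensor_relator : free -> Prop :=
| RelatorDl x x' y : tensor_relator (gen (x + x') y - gen x y - gen x' y)
| RelatorDr x y y' : tensor_relator (gen x (y + y') - gen x y - gen x y')
| RelatorM x s y : tensor_relator (gen (x * f s) y - gen x (f s * y)).

Definition tensor_rel : {pred free} := fun u =>
  `[< forall K : zmodClosed free,
        (forall v, tensor_relator v -> v \in K) -> u \in K >].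

Fact tensor_rel_zmod_closed : zmod_closed tensor_rel.
Proof.
split=> [|u v /asboolP uP /asboolP vP]; apply/asboolP => K KP.
  exact: rpred0.
by rewrite rpredB ?uP ?vP.
Qed.

HB.instance Definition _ :=
  GRing.isZmodClosed.Build free tensor_rel tensor_rel_zmod_closed.

Definition tensor : zmodType := Quotient.quot tensor_rel.

Definition pure_tensor (x y : A) : tensor := (\pi_tensor (gen x y))%qT.

Definition separable_extension := exists (n : nat) (x y : 'I_n -> A),
  (forall c : A, \sum_i pure_tensor (x i) (y i * c) =
                 \sum_i pure_tensor (c * x i) (y i)) /\
  \sum_i x i * y i = 1.

End Tensor.

(* Main.v *)
Require Import Defs.
From HB Require Import structures.
From mathcomp Require Import all_boot all_order all_algebra all_fingroup.
From mathcomp Require Import boolp classical_sets.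
From mathcomp Require Import freeg.

(** A ring is semisimple Artinian iff every left ideal [I] contains an element
    [e] acting as a right identity on [I] (so that [I = A e]).  This form
    descends along a bimodule retraction [E] of [RG] onto [RH], namely the
    truncation of functions to [H]: if [e] is a right identity of the left ideal
    [{x | E (RG x) <= I}], which contains [I], then [E e] is one of [I].
    It ascends to a separable extension by averaging: an [RH]-linear
    projection [p] of the finitely generated [RH]-module [RG] onto a left ideal [L] becomes the [RG]-linear projection
    [x |-> \sum_i a_i p (b_i x)], whose value at 1 is a right identity of [L]. *)

Set Implicit Arguments.
Unset Strict Implicit.
Unset Printing Implicit Defensive.
Import GRing.Theory.
Local Open Scope classical_set_scope.
Local Open Scope ring_scope.

(** * Left ideals and right identities *)

Section LeftIdeals.
Variable A : pzRingType.
Implicit Types (I K L M : set A) (x y e : A).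

Definition left_ideals_split :=
  forall I, left_ideal I -> exists2 e, I e & forall x, I x -> x * e = x.

Lemma left_idealD I x y : left_ideal I -> I x -> I y -> I (x + y).
Proof. by move=> [_ ID] Ix Iy; rewrite -[x]mul1r; apply: ID. Qed.

Lemma left_idealM I c x : left_ideal I -> I x -> I (c * x).
Proof. by move=> [I0 ID] Ix; rewrite -[c * x]addr0; apply: ID. Qed.

Lemma left_idealB I x y : left_ideal I -> I x -> I y -> I (x - y).
Proof. by move=> [_ ID] Ix Iy; rewrite addrC -mulN1r; apply: ID. Qed.

Lemma left_idealI I K : left_ideal I -> left_ideal K -> left_ideal (I `&` K).
Proof.
move=> [I0 ID] [K0 KD]; split=> // c x y [Ix Kx] [Iy Ky].
by split; [apply: ID | apply: KD].
Qed.

Lemma left_ideal_bigcup (T : Type) (D : set T) (F : T -> set A) :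
  D !=set0 -> (forall i, D i -> left_ideal (F i)) ->
  (forall i j, D i -> D j -> F i `<=` F j \/ F j `<=` F i) ->
  left_ideal (\bigcup_(i in D) F i).
Proof.
move=> [i Di] FL Ftot; split; first by exists i => //; case: (FL i Di).
move=> c x y [j Dj Fx] [k Dk Fy].
case: (Ftot j k Dj Dk) => sub.
  by exists k => //; case: (FL k Dk) => _; apply => //; apply: sub.
by exists j => //; case: (FL j Dj) => _; apply => //; apply: sub.
Qed.

Lemma ex_maximal_left_ideal I : left_ideal I -> ~ I 1 ->
  exists2 M, maximal_left_ideal M & I `<=` M.
Proof.
move=> IL I1.
(* The union with [I] makes the condition hold for the empty chain too. *)
pose P K := left_ideal (I `|` K) /\ ~ (I `|` K) 1.
have [F FP Ftot|M [[ML M1] Mmax]] := @Zorn_bigcup A P.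
  split; last by move=> [//|[K FK K1]]; case: (FP K FK) => _; apply; right.
  have [F0|F0] := pselect (F !=set0); last first.
    by rewrite bigcup0 ?setU0 // => K FK; case: F0; exists K.
  rewrite -bigcupUr //; apply: left_ideal_bigcup => // [K /FP[]//|K L FK FL].
  by case: (Ftot K L FK FL) => ?; [left | right]; apply: setUS.
exists (I `|` M) => //; split=> // L LL L1 sML.
have IL_L : I `|` L = L by apply/setUidPr => x Ix; apply: sML; left.
suff ML_eq : M = L by rewrite ML_eq.
apply: contrapT => neq; case: (Mmax L); last by rewrite /P IL_L.
rewrite properEneq; split; last by move=> x Mx; apply: sML; right.
exact/eqP.
Qed.

(** The left ideal [M + A x] properly contains [M], so maximality puts 1 in it. *)
Lemma maximal_left_ideal_comax M x : maximal_left_ideal M -> ~ M x ->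
  exists c, M (1 - c * x).
Proof.
move=> [ML M1 Mmax] Mx; apply: contrapT => /forallNP nM.
apply: Mx; rewrite -(Mmax [set y | exists c, M (y - c * x)]) //=.
- by exists 1; rewrite mul1r subrr; case: ML.
- split=> [|c y z [d My] [d' Mz]]; first by exists 0; rewrite mul0r subr0; case: ML.
  exists (c * d + d'); rewrite mulrDl opprD addrACA -mulrA -mulrBr.
  by case: ML => _; apply.
- by move=> [c /nM].
- by move=> y My /=; exists 0; rewrite mul0r subr0.
Qed.

(** Otherwise iterating a choice of a strictly smaller left ideal in [P], starting at [K], gives a
    descending chain that never stabilises. *)
Lemma left_artinian_min (P : set (set A)) K : left_artinian A ->
  left_ideal K -> P K ->
  exists L, [/\ left_ideal L, P L &
    forall L', left_ideal L' -> P L' -> L' `<=` L -> L' = L].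
Proof.
move=> artA KL PK; apply: contrapT => noL.
have /choice[f fP] L : exists L', left_ideal L -> P L ->
    [/\ left_ideal L', P L', L' `<=` L & L' <> L].
  apply: contrapT => /forallNP noL'; apply: noL; exists L.
  have [LL|nLL] := pselect (left_ideal L); last by case: (noL' L).
  have [PL|nPL] := pselect (P L); last by case: (noL' L).
  split=> // L' L'L PL' sL'; apply: contrapT => neq.
  by case: (noL' L').
have iterP n : left_ideal (iter n f K) /\ P (iter n f K).
  by elim: n => //= n [IL IP]; case: (fP _ IL IP).
have [n||N /(_ N.+1 (leqnSn N))] := artA (fun n => iter n f K).
- by case: (iterP n).
- by move=> n; case: (iterP n) => IL IP; case: (fP _ IL IP).
- by case: (iterP N) => IL IP; case: (fP _ IL IP).
Qed.

(* For [I], take [K] minimal with [K + I = A].  If [K] met [I] in some [x <> 0],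
   a maximal left ideal [M] missing [x] would give the smaller [K `&` M]. *)
Lemma semisimple_artinian_split : semisimple_artinian A -> left_ideals_split.
Proof.
move=> [artA J0] I IL.
pose P K := forall z, exists2 k, K k & I (z - k).
have [||K [KL PK Kmin]] := @left_artinian_min P setT artA; first by [].
  by move=> z; exists z => //; rewrite subrr; case: IL.
have KI0 x : K x -> I x -> x = 0.
  move=> Kx Ix; suff: jacobson_radical x by rewrite J0.
  move=> M Mmax; apply: contrapT => Mx.
  have [c Mc] := maximal_left_ideal_comax Mmax Mx.
  have ML : left_ideal M by case: Mmax.
  have KM : K `&` M = K.
    apply: Kmin => [|z|y []//]; first exact: left_idealI.
    (* The witness is in [M] because [1 - c * x] is; it differs from [k] by [k * c * x], which is in
       both [K] and [I]. *)
    have [k Kk Ik] := PK z; exists (k * (1 - c * x)).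
      split; last exact: left_idealM.
      by rewrite mulrBr mulr1 mulrA; apply: left_idealB => //; apply: left_idealM.
    rewrite mulrBr mulr1 opprB addrA addrAC mulrA.
    by apply: left_idealD => //; apply: left_idealM.
  by apply: Mx; move: Kx; rewrite -KM => -[].
(* For [x] in [I], the difference [x - x * (1 - k) = x * k] lies in [K] and in [I]. *)
have [k Kk Ik] := PK 1; exists (1 - k) => // x Ix.
apply/esym/subr0_eq/KI0; last by apply: left_idealB => //; apply: left_idealM.
by rewrite mulrBr mulr1 opprB addrCA subrr addr0; apply: left_idealM.
Qed.

(** The left annihilators of suitable right identities [f n] ascend, and their union is a left
    ideal. Its right identity [u] already lies in the annihilator of some [f N], and the chain is
    constant from [N] on. *)
Lemma split_left_artinian : left_ideals_split -> left_artinian A.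
Proof.
move=> splitA I IL Isub.
have /choice[e eP] n : exists e, I n e /\ forall x, I n x -> x * e = x.
  by have [e Ie eP] := splitA _ (IL n); exists e.
(* Unlike the [e n], the products [f n] have increasing left annihilators. *)
pose f := fix f n := if n is m.+1 then f m * e m.+1 else e 0%N.
have If n : I n (f n).
  by case: n => [|n] /=; [|apply: left_idealM => //]; apply: (eP _).1.
have fP n x : I n x -> x * f n = x.
  elim: n x => [|n IHn] x Ix /=; first by apply: (eP 0%N).2.
  by rewrite mulrA IHn; [apply: (eP n.+1).2 | apply: Isub].
have annS m n x : (m <= n)%N -> x * f m = 0 -> x * f n = 0.
  move=> /subnK <- x0; elim: (n - m)%N => //= k IHk.
  by rewrite mulrA IHk mul0r.
have Ile m n : (m <= n)%N -> I n `<=` I m.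
  move=> /subnK <-; elim: (n - m)%N => [//|k IHk] x.
  by rewrite addSn => /Isub/IHk.
have [|u [N _ uN] uP] := splitA (\bigcup_n [set x | x * f n = 0]).
  apply: left_ideal_bigcup => [|n _|m n _ _]; first by exists 0%N.
    split=> [|c x y /= x0 y0]; first by rewrite /= mul0r.
    by rewrite mulrDl -mulrA x0 y0 mulr0 addr0.
  by case: (leqP m n) => [|/ltnW] mn; [left | right] => x; apply: annS mn.
exists N => n Nn; apply/seteqP; split; first exact: Ile.
have fnN : f n * f N = f n by apply: fP; apply: Ile (If n).
have ann1 : (1 - f n) * u = 1 - f n.
  by apply: uP; exists n => //=; rewrite mulrBl mul1r fP ?subrr.
(* [f N] kills [1 - f n = (1 - f n) * u] from the right, so [f N = f n * f N = f n]. *)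
have fNn : f N = f n.
  apply/subr0_eq; rewrite -{1}[f N]mul1r -fnN -mulrBl -ann1 -mulrA.
  by rewrite uN mulr0.
by move=> x /fP <-; rewrite fNn; apply: left_idealM.
Qed.

(** A right identity [e] of the radical is idempotent. Without a left inverse, [1 - e] would lie in
    a maximal left ideal, which also contains [e], hence 1. So [1 - e] is left invertible, and
    [(1 - e) * e = 0] gives [e = 0]. *)
Lemma split_jacobson_radical0 :
  left_ideals_split -> @jacobson_radical A = [set 0].
Proof.
move=> splitA; apply/seteqP; split=> [x Jx|x -> M [[]//]].
have JL : left_ideal (@jacobson_radical A).
  split=> [M [[]//]|c y z Jy Jz M Mm].
  by case: (Mm) => -[_ MD] _ _; apply: MD; [apply: Jy | apply: Jz].
have [e Je eP] := splitA _ JL.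
have ee : e * e = e by apply: eP.
suff [c c1] : exists c, 1 = c * (1 - e).
  rewrite /= -(eP _ Jx) -[e]mul1r c1 -mulrA mulrBl mul1r ee subrr.
  by rewrite !mulr0.
apply: contrapT => nc.
have [|M Mm sM] := @ex_maximal_left_ideal [set y | exists c, y = c * (1 - e)] _ nc.
  split=> [|c y z [d ->] [d' ->]]; first by exists 0; rewrite mul0r.
  by exists (c * d + d'); rewrite mulrDl mulrA.
case: (Mm) => ML M1 _; apply: M1; rewrite -(subrK e 1).
by apply: (left_idealD ML); [apply: sM; exists 1; rewrite mul1r | apply: Je].
Qed.

Lemma semisimple_artinianE : semisimple_artinian A <-> left_ideals_split.
Proof.
split; first exact: semisimple_artinian_split.
by move=> splitA; split; [apply: split_left_artinian | apply: split_jacobson_radical0].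
Qed.

End LeftIdeals.

(** * Descent along a bimodule retraction *)

Section Retract.
Variables (S A : pzRingType) (f : {rmorphism S -> A}) (E : {additive A -> S}).
Hypothesis fE : cancel f E.
Hypothesis El : forall s x, E (f s * x) = s * E x.
Hypothesis Er : forall s x, E (x * f s) = E x * s.

Lemma retract_left_ideals_split : left_ideals_split A -> left_ideals_split S.
Proof.
move=> splitA I IL.
have [|e Ie eP] := splitA [set x | forall c, I (E (c * x))].
  split=> [c|c x y Ix Iy d]; first by rewrite mulr0 raddf0; case: IL.
  by rewrite mulrDr raddfD mulrA; apply: left_idealD.
exists (E e) => [|s Is]; first by rewrite -[e]mul1r.
(* [f s] is in the enlarged ideal since [E (c * f s) = E c * s]. *)
rewrite -El eP ?fE //= => c; rewrite Er; exact: left_idealM.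
Qed.

End Retract.

(** * Maps out of the tensor product *)

Section Tensor.
Variables (S A : pzRingType) (f : {rmorphism S -> A}).

(** Universal property of the tensor product, in the form in which the separability identity uses
    it. *)
Lemma tensor_sum_lift (V : zmodType) (phi : A -> A -> V)
    (I : Type) (r : seq I) (x y x' y' : I -> A) :
  (forall u u' v, phi (u + u') v = phi u v + phi u' v) ->
  (forall u v v', phi u (v + v') = phi u v + phi u v') ->
  (forall u s v, phi (u * f s) v = phi u (f s * v)) ->
  \sum_(i <- r) pure_tensor f (x i) (y i) =
    \sum_(i <- r) pure_tensor f (x' i) (y' i) ->
  \sum_(i <- r) phi (x i) (y i) = \sum_(i <- r) phi (x' i) (y' i).
Proof.
move=> phiDl phiDr phiM.
have [lift liftB lift_gen] : exists2 lift : {freeg (A * A)%type} -> V,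
    forall u v, lift (u - v) = lift u - lift v &
    forall u v, lift << (u, v) >> = phi u v.
  exists (fglift (fun u => phi u.1 u.2 : zmodule V)) => u v.
    exact: (lift_is_additive (fun u => phi u.1 u.2 : zmodule V)).
  by rewrite liftU scale1r.
have lift0 : lift 0 = 0 by have := liftB 0 0; rewrite !subrr.
(* [tensor_rel] is the least subgroup containing the relators, so it lies in the kernel [K] once
   they do. *)
pose K : {pred {freeg (A * A)%type}} := fun u => lift u == 0.
have KP : zmod_closed K.
  split=> [|u v /eqP u0 /eqP v0]; apply/eqP; first exact: lift0.
  by rewrite liftB u0 v0 subr0.
pose KC : zmodClosed _ := HB.pack K (GRing.isZmodClosed.Build _ K KP).
have lift_relator v : tensor_relator f v -> v \in (KC : {pred _}).
  case=> [u u' w|u w w'|u s w]; apply/eqP; rewrite !liftB !lift_gen.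
  - by rewrite phiDl addrAC addrK subrr.
  - by rewrite phiDr addrAC addrK subrr.
  - by rewrite phiM subrr.
have lift_rel u v : (\pi_(tensor f) u = \pi_(tensor f) v)%qT -> lift u = lift v.
  move=> /eqP; rewrite -Quotient.idealrBE => /asboolP/(_ KC lift_relator)/eqP.
  by rewrite liftB => /subr0_eq.
have liftD : {morph lift : u v / u + v}.
  by move=> u v; rewrite -{1}[v]opprK liftB -[- v]sub0r liftB lift0 sub0r opprK.
have lift_sum F := big_morph lift liftD lift0 r xpredT F.
rewrite /pure_tensor -!raddf_sum => /lift_rel; rewrite !lift_sum.
by under eq_bigr do rewrite lift_gen; under [RHS]eq_bigr do rewrite lift_gen.
Qed.

End Tensor.

(** * Ascent to a separable extension *)

Section SeparableExtension.
Variables (S A : pzRingType) (f : {rmorphism S -> A}).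

Definition submodule_along (N : set A) :=
  N 0 /\ forall s x y, N x -> N y -> N (f s * x + y).

(** Induction on [ms], enlarging [K] by one cyclic module. With [e] a right identity of the ideal of
    those [s] with [f s * m] in [N + K], the module generated by [m' = (1 - f e) * m] meets [N + K]
    only in 0. *)
Lemma submodule_complement (N : set A) (ms : seq A) :
  left_ideals_split S -> submodule_along N ->
  exists K, [/\ submodule_along K, (forall x, N x -> K x -> x = 0) &
    forall m, m \in ms -> exists2 n, N n & K (m - n)].
Proof.
move=> splitS [N0 ND]; elim: ms => [|m ms [K [[K0 KD] NK0 Kms]]].
  exists [set 0]; split=> //; split=> // s x y -> -> /=.
  by rewrite mulr0 addr0.
pose I := [set s : S | exists2 n, N n & K (f s * m - n)].
have [|e [ne Nne Ke] eP] := splitS I.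
  split=> [|s t t' [n Nn Kn] [n' Nn' Kn']].
    by exists 0 => //; rewrite rmorph0 mul0r subrr.
  exists (f s * n + n'); first exact: ND.
  by rewrite rmorphD rmorphM mulrDl opprD addrACA -mulrA -mulrBr; apply: KD.
pose m' := (1 - f e) * m.
(* Here [s * (1 - e)] is in [I], so it equals [s * (1 - e) * e = 0]. *)
have m'0 s n : N n -> K (f s * m' - n) -> f s * m' = 0.
  move=> Nn Kn; have Is : I (s * (1 - e)).
    by exists n => //; rewrite rmorphM rmorphB rmorph1 -mulrA.
  have ee : e * e = e by apply: eP; exists ne.
  rewrite mulrA -[1 in LHS](rmorph1 f) -rmorphB -rmorphM -(eP _ Is).
  by rewrite -mulrA mulrBl mul1r ee subrr mulr0 rmorph0 mul0r.
exists [set x | exists s, K (x - f s * m')]; split.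
- split=> [|s x y [t Kx] [t' Ky]]; first by exists 0; rewrite rmorph0 mul0r subrr.
  exists (s * t + t').
  by rewrite rmorphD rmorphM mulrDl opprD addrACA -mulrA -mulrBr; apply: KD.
- move=> x Nx [s Kx].
  have sm'0 : f s * m' = 0.
    apply: m'0 Nx _; rewrite -opprB -[- _]addr0 -mulN1r -(rmorphN1 f).
    exact: KD.
  by apply: NK0 Nx _; rewrite -[x]subr0 -sm'0.
- move=> k; rewrite inE => /predU1P[->|/Kms[n Nn Kn]]; last first.
    by exists n => //; exists 0; rewrite rmorph0 mul0r subr0.
  (* [m - ne - m' = f e * m - ne], which is in [K]. *)
  exists ne => //; exists 1.
  by rewrite rmorph1 mul1r /m' mulrBl mul1r opprB addrC addrA subrK.
Qed.

(** A complement [K] for the generators gives [A = N + K], a direct sum; [p] picks the component in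
    [N], and uniqueness of components makes it linear. *)
Lemma submodule_projection (I : finType) (m : I -> A) (N : set A) :
  (forall x, exists c : I -> S, x = \sum_i f (c i) * m i) ->
  left_ideals_split S -> submodule_along N ->
  exists p : A -> A, [/\ forall x, N (p x), forall n, N n -> p n = n,
    {morph p : x y / x + y} & forall s x, p (f s * x) = f s * p x].
Proof.
move=> mgen splitS NS.
have [K [[K0 KD] NK0 Km]] := submodule_complement (map m (enum I)) splitS NS.
case: NS => N0 ND.
have /choice[p pP] x : exists n, N n /\ K (x - n).
  have [c ->] := mgen x; elim/big_ind: _ => [|u v [n [Nn Kn]] [n' [Nn' Kn']]|i _].
  - by exists 0; rewrite subrr.
  - exists (f 1 * n + n'); split; first exact: ND.
    by rewrite -[u]mul1r -(rmorph1 f) opprD addrACA -mulrBr; apply: KD.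
  - have [|n Nn Kn] := Km (m i); first by rewrite map_f ?mem_enum.
    exists (f (c i) * n + 0); split; first exact: ND.
    by rewrite addr0 -mulrBr -[_ * _]addr0; apply: KD.
have p_uniq x n : N n -> K (x - n) -> p x = n.
  move=> Nn Kn; have [Npx Kpx] := pP x; apply/subr0_eq/NK0.
    by rewrite addrC -mulN1r -(rmorphN1 f); apply: ND.
  have -> : p x - n = f (-1) * (x - p x) + (x - n).
    by rewrite rmorphN1 mulN1r opprB addrA subrK.
  exact: KD.
exists p; split=> [x|n Nn|x y|s x]; first by case: (pP x).
- by apply: p_uniq; rewrite ?subrr.
- have [[Nx Kx] [Ny Ky]] := (pP x, pP y); apply: p_uniq.
    by rewrite -[p x]mul1r -(rmorph1 f); apply: ND.
  by rewrite opprD addrACA -[x - _]mul1r -(rmorph1 f); apply: KD.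
- have [Nx Kx] := pP x; apply: p_uniq.
    by rewrite -[_ * _]addr0; apply: ND.
  by rewrite -mulrBr -[_ * _]addr0; apply: KD.
Qed.

Lemma separable_left_ideals_split (I : finType) (m : I -> A) :
  (forall x, exists c : I -> S, x = \sum_i f (c i) * m i) ->
  separable_extension f -> left_ideals_split S -> left_ideals_split A.
Proof.
move=> mgen [n [x [y [xyC xy1]]]] splitS L LL.
have [|p [pL pid pD pM]] := submodule_projection (N := L) mgen splitS.
  by split=> [|s u v]; [case: LL | case: LL => _; apply].
exists (\sum_i x i * p (y i)) => [|c Lc].
  elim/big_ind: _ => [|u v|i _]; first by case: LL.
    exact: left_idealD.
  exact: left_idealM.
rewrite mulr_sumr; under eq_bigr do rewrite mulrA.
(* The separability identity moves [c] inside [p], where [y i * c] is in [L] and hence fixed. *)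
rewrite -(tensor_sum_lift (phi := fun u v => u * p v) _ _ _ (xyC c)).
- rewrite -[RHS]mul1r -xy1 mulr_suml; apply: eq_bigr => i _.
  by rewrite pid ?mulrA //; apply: left_idealM.
- by move=> u u' v; rewrite mulrDl.
- by move=> u v v'; rewrite pD mulrDr.
- by move=> u s v; rewrite pM mulrA.
Qed.

End SeparableExtension.

(** * The skew group ring over that of a subgroup *)

Section SkewGroupRing.
Variables (R : pzRingType) (gT : finGroupType) (a : ring_action gT R).
Variable H : {group gT}.
Local Notation RG := (skew_group_ring a).
Local Notation RH := (skew_group_ring (restr_act a H)).
Local Notation incl := (skew_incl (H := H) : {rmorphism RH -> RG}).

Definition skew_trunc (x : RG) : RH := [ffun h => x (sgval h)].

Fact skew_trunc_zmod_morphism : zmod_morphism skew_trunc.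
Proof. by move=> x y; apply/ffunP => h; rewrite !ffunE. Qed.

HB.instance Definition _ :=
  GRing.isZmodMorphism.Build RG RH skew_trunc skew_trunc_zmod_morphism.

Lemma skew_inclK : cancel incl skew_trunc.
Proof. by move=> x; apply/ffunP => h; rewrite ffunE skew_inclE. Qed.

Lemma sum_subg (F : gT -> R) : (forall g, g \notin H -> F g = 0) ->
  \sum_g F g = \sum_(h : subg_of H) F (sgval h).
Proof.
move=> F0; rewrite (bigID (mem H)) /= [X in _ + X]big1 ?addr0 //.
rewrite (reindex_onto (@sgval gT H) (subg H)) /= => [|g]; last exact: subgK.
by apply: eq_bigl => h; rewrite subgP sgvalK eqxx.
Qed.

Lemma skew_truncMl (s : RH) (x : RG) :
  skew_trunc (incl s * x) = s * skew_trunc x.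
Proof.
apply/ffunP => k; rewrite !ffunE sum_subg => [|g gH].
  by apply: eq_bigr => h _; rewrite skew_inclE ffunE.
by rewrite skew_incl_out // mul0r.
Qed.

(** For [k] in [H] and [g] outside, [g^-1 * k] is outside [H], so only terms with [g] in [H]
    survive. *)
Lemma skew_truncMr (s : RH) (x : RG) :
  skew_trunc (x * incl s) = skew_trunc x * s.
Proof.
apply/ffunP => k; rewrite !ffunE sum_subg => [|g gH].
  apply: eq_bigr => h _.
  by rewrite -[(_^-1 * _)%g]/(sgval (h^-1 * k)%g) skew_inclE ffunE.
by rewrite skew_incl_out ?rmorph0 ?mulr0 // groupMr ?groupV // subgP.
Qed.

Lemma skew_incl_single r (h : subg_of H) :
  incl (skew_single (restr_act a H) r h) = skew_single a r (sgval h).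
Proof.
apply/ffunP => k; rewrite !ffunE; case: insubP => [l _ <-|kH].
  by rewrite ffunE (inj_eq val_inj).
by case: eqP kH => // ->; rewrite subgP.
Qed.

(** Finite generation of [RG] over [RH]; indexing by all of [gT] avoids choosing coset
    representatives. *)
Lemma skew_group_ring_span (x : RG) :
  exists c : gT -> RH, x = \sum_g incl (c g) * skew_single a 1 g.
Proof.
exists (fun g => skew_single (restr_act a H) (x g) 1%g).
under eq_bigr do rewrite skew_incl_single skew_singleM rmorph1 mulr1 mul1g.
apply/ffunP => k; rewrite sum_ffunE (bigD1 k) //= big1 => [|g gk].
  by rewrite ffunE eqxx addr0.
by rewrite ffunE eq_sym (negPf gk).
Qed.

End SkewGroupRing.

Theorem corollary6p8 (R : pzRingType) (gT : finGroupType)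
    (a : ring_action gT R) (H : {group gT}) :
  let RG := skew_group_ring a in
  let RH := skew_group_ring (restr_act a H) in
  (semisimple_artinian RG -> semisimple_artinian RH) /\
  (separable_extension (skew_incl (H := H) : {rmorphism RH -> RG}) ->
     (semisimple_artinian RG <-> semisimple_artinian RH)).
Proof.
move=> RG RH.
have desc : semisimple_artinian RG -> semisimple_artinian RH.
  move=> /semisimple_artinianE splitG; apply/semisimple_artinianE.
  apply: (retract_left_ideals_split (@skew_inclK _ _ a H)) splitG.
    exact: skew_truncMl.
  exact: skew_truncMr.
split=> // sep; split=> // /semisimple_artinianE splitH.
apply/semisimple_artinianE/(separable_left_ideals_split _ sep splitH).
exact: skew_group_ring_span.
Qed.
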